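(* Fix integers $n\ge 1$ and degrees $m=(m_1,\ldots,m_{n+1})$ with each $m_j\ge 1$, and fix a $p$-norm. There exist positive scalars $c_m$ and $c_m'$, depending only on the degrees (and $n$) and on the choice of norm, such that the following holds. Let $f:[0,1]^{n+1}\to\mathbb{R}^n$ be a polynomial of degrees $m$ that is nondegenerate, i.e., there is no $x\in[0,1]^{n+1}$ with $f(x)=0$ and $\operatorname{rank}(f'(x))<n$. Then: (1) every polynomial $\tilde f$ of degrees $m$ satisfying $$\frac{\|\tilde f-f\|}{\|f\|}\le \frac{c_m}{\kappa(f)}$$ is nondegenerate; (2) conversely, there exists a degenerate polynomial $\hat f$ of degrees $m$ such that $$\frac{\|\hat f-f\|}{\|f\|}\le \frac{c_m'}{\kappa(f)}.$$
   Context: A polynomial $g:[0,1]^{n+1}\to\mathbb{R}^n$ of degrees $m=(m_1,\ldots,m_{n+1})$ is written in tensor-product Bernstein–Bézier form $g(x)=\sum_{i_1=0}^{m_1}\cdots\sum_{i_{n+1}=0}^{m_{n+1}} b_{i_1,\ldots,i_{n+1}} Z_{i_1,m_1}(x_1)\cdots Z_{i_{n+1},m_{n+1}}(x_{n+1})$ with control points $b_{i_1,\ldots,i_{n+1}}\in\mathbb{R}^n$, where $Z_{i,m}(t)=\frac{m!}{i!(m-i)!}(1-t)^{m-i}t^i$. The norm $\|g\|$ of such a polynomial is the maximum of the chosen $p$-norm of its control points. Matrix norms are the induced operator norms. For an $n\times(n+1)$ matrix $A$ of rank $n$, $A^\dagger=A^T(AA^T)^{-1}$. The condition number is $$\kappa(f)=\|f\|\cdot\max_{x\in[0,1]^{n+1}}\min\left\{\frac{1}{\|f(x)\|},\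 \|f'(x)^\dagger\|\right\},$$ where $1/\|f(x)\|$ is taken to be $\infty$ if $f(x)=0$, and $\|f'(x)^\dagger\|$ is taken to be $\infty$ if $\operatorname{rank}(f'(x))<n$. A polynomial is degenerate if there is $x\in[0,1]^{n+1}$ with $f(x)=0$ and $\operatorname{rank}(f'(x))<n$. *)

(* Defs.v *)
From HB Require Import structures.
From mathcomp Require Import all_boot all_order all_algebra.
From mathcomp Require Import all_classical all_reals all_analysis.
Set Implicit Arguments. Unset Strict Implicit. Unset Printing Implicit Defensive.
Import Order.TTheory GRing.Theory Num.Theory.
Import numFieldNormedType.Exports.
Local Open Scope classical_set_scope.
Local Open Scope ring_scope.

Section Defs.
Variable R : realType.

(* entrywise p-norm of a matrix (for row/column vectors: the usual p-norm),
   p in [1, +oo] encoded as an extended real *)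
Definition pnorm (p : \bar R) (a b : nat) (v : 'M[R]_(a, b)) : R :=
  match p with
  | r%:E => (\sum_(i < a) \sum_(j < b) `|v i j| `^ r) `^ r^-1
  | +oo%E => \big[Num.max/0]_(i < a) \big[Num.max/0]_(j < b) `|v i j|
  | -oo%E => 0
  end.

Definition opnorm (p : \bar R) (l k : nat) (B : 'M[R]_(l, k)) : R :=
  sup [set pnorm p (B *m x) | x in [set x : 'cV[R]_k | pnorm p x = 1]].

(* Moore–Penrose pseudo-inverse of a full-rank n x (n+1) matrix *)
Definition pinv (a b : nat) (A : 'M[R]_(a, b)) : 'M[R]_(b, a) :=
  A^T *m invmx (A *m A^T).

Definition bern (m i : nat) (t : R) : R :=
  'C(m, i)%:R * (1 - t) ^+ (m - i) * t ^+ i.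

Definition bidx (n : nat) (m : 'I_n.+1 -> nat) :=
  {dffun forall j : 'I_n.+1, 'I_(m j).+1}.

(* a polynomial [0,1]^{n+1} -> R^n of degrees m, given by its control points *)
Definition bpoly (n : nat) (m : 'I_n.+1 -> nat) :=
  {ffun bidx m -> 'rV[R]_n}.

Definition beval n (m : 'I_n.+1 -> nat) (g : bpoly m) (x : 'rV[R]_n.+1) : 'rV[R]_n :=
  \sum_(i : bidx m) (\prod_(j < n.+1) bern (m j) (i j) (x ord0 j)) *: g i.

Definition jac n (m : 'I_n.+1 -> nat) (g : bpoly m) (x : 'rV[R]_n.+1) : 'M[R]_(n, n.+1) :=
  \matrix_(k < n, j < n.+1) ('D_(delta_mx ord0 j) (beval g) x) ord0 k.

Definition bnorm (p : \bar R) n (m : 'I_n.+1 -> nat) (g : bpoly m) : R :=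
  \big[Num.max/0]_(i : bidx m) pnorm p (g i).

Definition cube (n : nat) : set 'rV[R]_n.+1 :=
  [set x | forall j, 0 <= x ord0 j <= 1].

Definition degenerate n (m : 'I_n.+1 -> nat) (g : bpoly m) : Prop :=
  exists2 x, x \in @cube n & beval g x = 0 /\ (\rank (jac g x) < n)%N.

Definition kappa_loc (p : \bar R) n (m : 'I_n.+1 -> nat) (g : bpoly m) (x : 'rV[R]_n.+1) : \bar R :=
  Order.min
    (if beval g x == 0 then +oo%E else ((pnorm p (beval g x))^-1)%:E)
    (if (\rank (jac g x) < n)%N then +oo%E else (opnorm p (pinv (jac g x)))%:E).

Definition kappa (p : \bar R) n (m : 'I_n.+1 -> nat) (g : bpoly m) : \bar R :=
  ((bnorm p g)%:E * ereal_sup [set kappa_loc p g x | x in @cube n])%E.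

End Defs.

(* Main.v *)
Require Import Defs.
From HB Require Import structures.
From mathcomp Require Import all_boot all_order all_algebra.
From mathcomp Require Import all_classical all_reals all_analysis.
From mathcomp Require Import ring lra.
Set Implicit Arguments. Unset Strict Implicit. Unset Printing Implicit Defensive.
Import Order.TTheory GRing.Theory Num.Theory.
Import numFieldNormedType.Exports.
Local Open Scope ring_scope.

(* Everything is measured entrywise, since every p-norm is equivalent to the
   maximum norm.  If ft is degenerate at x, then ft - f moves the value f(x) to 0
   and the Jacobian f'(x) to a rank-deficient matrix; evaluating and
   differentiating are bounded on control points, so ft - f has size at least
   a multiple of max(|f(x)|, 1 / |f'(x)^+|), and the reciprocal of this maximum
   is at most the supremum in kappa(f).  Conversely, at a point x nearly
   attaining that supremum, a rank-one matrix E of size O(1 / |f'(x)^+|) makes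
   f'(x) + E rank deficient, and adding the affine map
   y |-> - f(x) + E (y - x), which the Bernstein form represents with control
   points of the same size, makes f degenerate at x.  The supremum is finite
   because |f(x)| + |u f'(x)| has a positive minimum over the compact product
   of the cube with the unit sphere of row vectors u. *)

(** * Comparison of p-norms and operator norms with absolute values of entries *)

Section Norms.
Variable R : realType.
Implicit Types (p : \bar R).

Lemma sqr_le_sum (T : finType) (F : T -> R) i : F i ^+ 2 <= \sum_j F j ^+ 2.
Proof.
by rewrite (bigD1 i)//= lerDl; apply: sumr_ge0 => *; exact: sqr_ge0.
Qed.

Lemma norm_sum_le k (F : 'I_k -> R) B :
  (forall i, `|F i| <= B) -> `|\sum_i F i| <= k%:R * B.
Proof.
move=> FB; apply: le_trans (ler_norm_sum _ _ _) _.
by rewrite -[in leRHS](card_ord k) mulr_natl -sumr_const ler_sum.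
Qed.

Lemma entry_le_pnorm p a b (v : 'M[R]_(a, b)) i j :
  (1 <= p)%E -> `|v i j| <= pnorm p v.
Proof.
case: p => [r| |] //= p1; last first.
  apply: (le_trans _ (le_bigmax_cond _ _ _)) => //.
  exact: (le_bigmax_cond _ (fun j => `|v i j|)).
have {}p1 : 1 <= r by rewrite -lee_fin.
have r0 : r != 0 by lra.
rewrite -[leLHS](@powRr1 R)// -[X in _ `^ X](mulfV r0) powRrM.
apply: ge0_ler_powR; rewrite ?nnegrE ?invr_ge0 ?powR_ge0//; first lra.
  by apply: sumr_ge0 => ? _; apply: sumr_ge0 => ? _; exact: powR_ge0.
rewrite (bigD1 i)//= (bigD1 j)//= -addrA lerDl addr_ge0//.
  by apply: sumr_ge0 => ? _; exact: powR_ge0.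
by apply: sumr_ge0 => ? _; apply: sumr_ge0 => ? _; exact: powR_ge0.
Qed.

(** One crude factor serves every p: with [N = (a * b).+1], a finite power sum is at most
    [N * B ^ r], and [N <= N ^ r] since [N >= 1]. The successor keeps N at least 1 for empty
    matrices. *)
Lemma pnorm_le_entries p a b (v : 'M[R]_(a, b)) B :
  (1 <= p)%E -> 0 <= B -> (forall i j, `|v i j| <= B) ->
  pnorm p v <= (a * b).+1%:R * B.
Proof.
case: p => [r| |] //= p1 B0 vB; last first.
  have : \big[Num.max/0]_(i < a) \big[Num.max/0]_(j < b) `|v i j| <= B.
    by apply/bigmax_leP; split => // i _; apply/bigmax_leP; split.
  by move/le_trans; apply; rewrite ler_peMl// ler1n.
have {}p1 : 1 <= r by rewrite -lee_fin.
have r0 : r != 0 by lra.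
have -> : (a * b).+1%:R * B = ((a * b).+1%:R `^ r * B `^ r) `^ r^-1.
  by rewrite -powRM// -powRrM mulfV// powRr1// mulr_ge0.
apply: ge0_ler_powR; rewrite ?nnegrE ?invr_ge0 ?mulr_ge0 ?powR_ge0//; first lra.
  by apply: sumr_ge0 => ? _; apply: sumr_ge0 => ? _; exact: powR_ge0.
apply: (@le_trans _ _ ((a * b)%:R * B `^ r)).
  rewrite natrM -mulrA -[in leRHS](card_ord a) -[in leRHS](card_ord b).
  rewrite mulr_natl -sumr_const; apply: ler_sum => i _.
  rewrite mulr_natl -sumr_const; apply: ler_sum => j _.
  by apply: ge0_ler_powR; rewrite ?nnegrE//; lra.
rewrite ler_wpM2r ?powR_ge0// (@le_trans _ _ (a * b).+1%:R) ?ler_nat//.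
by rewrite -{1}[_%:R]powRr1// ler_powR// ler1n.
Qed.

Lemma pnorm_ge0 p a b (v : 'M[R]_(a, b)) : 0 <= pnorm p v.
Proof. by case: p => [r| |] //=; [exact: powR_ge0|exact: bigmax_ge_id]. Qed.

Lemma pnorm0_eq0 p a b (v : 'M[R]_(a, b)) :
  (1 <= p)%E -> pnorm p v <= 0 -> v = 0.
Proof.
move=> p1 v0; apply/matrixP => i j; rewrite mxE; apply/eqP.
by rewrite -normr_le0 (le_trans _ v0)// entry_le_pnorm.
Qed.

Lemma pnorm_delta p a b (i : 'I_a) (j : 'I_b) :
  (1 <= p)%E -> pnorm p (delta_mx i j : 'M[R]_(a, b)) = 1.
Proof.
case: p => [r| |] //= p1; last first.
  apply/eqP; rewrite eq_le; apply/andP; split.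
    apply/bigmax_leP; split => // k _; apply/bigmax_leP; split => // l _.
    by rewrite mxE; case: (_ && _); rewrite ?normr1 ?normr0.
  apply: (le_trans _ (le_bigmax_cond _ _ (erefl : xpredT i))).
  apply: (le_trans _ (le_bigmax_cond _ _ (erefl : xpredT j))).
  by rewrite mxE !eqxx normr1.
have {}p1 : 1 <= r by rewrite -lee_fin.
have r0 : r != 0 by lra.
rewrite (bigD1 i)//= (bigD1 j)//= mxE !eqxx normr1 powR1 !big1 ?addr0 ?powR1//.
  move=> k /negPf ki; rewrite big1// => l _.
  by rewrite mxE ki normr0 powR0.
by move=> l /negPf lj; rewrite mxE eqxx lj normr0 powR0.
Qed.

Lemma pnorm_mulmx_le p l k (B : 'M[R]_(l, k)) (x : 'cV[R]_k) M :
  (1 <= p)%E -> 0 <= M -> (forall i j, `|B i j| <= M) -> pnorm p x = 1 ->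
  pnorm p (B *m x) <= (l.+1 * k)%:R * M.
Proof.
move=> p1 M0 BM x1; rewrite natrM -mulrA -[in l.+1](muln1 l).
apply: pnorm_le_entries; rewrite ?mulr_ge0// => i j.
rewrite mxE; apply: norm_sum_le => h.
rewrite normrM -[M]mulr1 ler_pM// -x1; exact: entry_le_pnorm.
Qed.

Lemma opnorm_le_entries p l k (B : 'M[R]_(l, k)) M :
  (1 <= p)%E -> (0 < k)%N -> 0 <= M -> (forall i j, `|B i j| <= M) ->
  opnorm p B <= (l.+1 * k)%:R * M.
Proof.
move=> p1 k0 M0 BM; apply: ge_sup => [|_ [x /= x1 <-]].
  by eexists; exists (delta_mx (Ordinal k0) ord0) => //=; exact: pnorm_delta.
exact: pnorm_mulmx_le.
Qed.

Lemma mulmx_delta l k (B : 'M[R]_(l, k)) i j :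
  (@mulmx R l k 1 B (delta_mx j ord0)) i ord0 = B i j.
Proof. by move/matrixP: (colE j B) => /(_ i ord0); rewrite mxE => <-. Qed.

Lemma entry_le_opnorm p l k (B : 'M[R]_(l, k)) i j :
  (1 <= p)%E -> `|B i j| <= opnorm p B.
Proof.
move=> p1; apply: (@le_trans _ _ (pnorm p (B *m (delta_mx j ord0 : 'cV[R]_k)))).
  by apply: le_trans (entry_le_pnorm _ i ord0 p1); rewrite mulmx_delta.
apply: ub_le_sup; last first.
  by exists (delta_mx j ord0) => //=; exact: pnorm_delta.
(* Any upper bound will do; for an unbounded set [sup] would take its default value 0. *)
exists ((l.+1 * k)%:R * \sum_i \sum_j `|B i j|) => _ [x /= x1 <-].
apply: pnorm_mulmx_le => //.
  by do 2! (apply: sumr_ge0 => ? _).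
move=> i' j'; rewrite (bigD1 i')//= (bigD1 j')//= -addrA lerDl addr_ge0//.
  by apply: sumr_ge0.
by do 2! (apply: sumr_ge0 => ? _).
Qed.

End Norms.

(** * Rank-deficient matrices close to a given one *)

Section NearSingular.
Variable R : realType.

(** Turns rank deficiency into a linear equation in u, the form in which all later estimates use
    it. *)
Lemma rank_lt_left_ker a b (A : 'M[R]_(a, b)) :
  (\rank A < a)%N <-> exists2 u : 'rV[R]_a, u != 0 & u *m A = 0.
Proof.
have -> : (\rank A < a)%N = (kermx A != 0).
  by rewrite kermx_eq0 /row_free ltn_neqAle rank_leq_row andbT.
split=> [/rowV0Pn [u /sub_kermxP uA u0]|[u u0 uA]]; first by exists u.
by apply/rowV0Pn; exists u => //; apply/sub_kermxP.
Qed.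

Lemma mul_row_tr (b : nat) (w : 'rV[R]_b) :
  (w *m w^T) ord0 ord0 = \sum_j w ord0 j ^+ 2.
Proof. by rewrite mxE; apply: eq_bigr => j _; rewrite mxE expr2. Qed.

(** If u kills [A *m A^T], then [u *m A] has Euclidean norm 0, so u is a left kernel vector of A. *)
Lemma gram_unit a b (A : 'M[R]_(a, b)) :
  (\rank A >= a)%N -> A *m A^T \in unitmx.
Proof.
move=> rA; rewrite -row_free_unit -kermx_eq0; apply/negPn/negP.
move=> /rowV0Pn [u /sub_kermxP uA u0].
suff uA0 : u *m A = 0.
  have : (\rank A < a)%N by apply/rank_lt_left_ker; exists u.
  by rewrite ltnNge rA.
have : ((u *m A) *m (u *m A)^T) ord0 ord0 = 0.
  by rewrite trmx_mul -!mulmxA (mulmxA A) (mulmxA u) uA mul0mx mxE.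
rewrite mul_row_tr => s0; apply/rowP => j; rewrite [RHS]mxE.
apply/eqP; rewrite -sqrf_eq0 eq_le sqr_ge0 andbT -s0.
exact: (sqr_le_sum (fun j => (u *m A) ord0 j)).
Qed.

Lemma mulmx_pinv a b (A : 'M[R]_(a, b)) :
  (\rank A >= a)%N -> A *m Defs.pinv A = 1%:M.
Proof. by move=> rA; rewrite /Defs.pinv mulmxA mulmxV// gram_unit. Qed.

(* With v the j-th column of the pseudo-inverse, the rank-one correction
   - e_j v^T / |v|^2 makes row j of (A A^T)^-1 a left kernel vector. *)
Lemma near_singular (p : \bar R) a b (A : 'M[R]_(a, b)) (t : R) :
  (1 <= p)%E -> (0 < a)%N -> 0 < t ->
  ((\rank A >= a)%N -> t <= opnorm p (Defs.pinv A)) ->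
  exists2 E : 'M[R]_(a, b), (forall i j, `|E i j| <= 2 * (b.+1 * a)%:R / t) &
    (\rank (A + E)%R < a)%N.
Proof.
move=> p1 a0 t0 At; have [rA|rA] := ltnP (\rank A) a.
  exists 0; last by rewrite addr0.
  move=> i j; rewrite mxE normr0 divr_ge0 ?mulr_ge0//.
  exact: ltW.
have {At} tA := At rA; set C : R := (b.+1 * a)%:R.
have C0 : 0 < C by rewrite ltr0n muln_gt0.
(* If no entry of the pseudo-inverse exceeded s, its operator norm would be at most
   [C * s = t / 2 < t]. *)
pose s := t / (2 * C); have s0 : 0 < s by rewrite divr_gt0// mulr_gt0.
have {p1 tA}[i [j ij]] : exists i j, s < `|Defs.pinv A i j|.
  apply: contrapT => /forallNP nij.
  have : opnorm p (Defs.pinv A) <= C * s.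
    apply: opnorm_le_entries => //; first exact: ltW.
    move=> i j; rewrite leNgt; apply/negP => sij.
    by apply: (nij i); exists j.
  rewrite leNgt => /negP; apply; apply: lt_le_trans tA.
  have -> : C * s = t / 2 by rewrite mulrC /s invfM mulrA divfK ?lt0r_neq0.
  by rewrite ltr_pdivrMr// ltr_pMr// ltr1n.
pose q := \sum_i Defs.pinv A i j ^+ 2.
have sq : s ^+ 2 <= q.
  apply: le_trans (sqr_le_sum (fun i => Defs.pinv A i j) i).
  by rewrite -(real_normK (num_real (Defs.pinv A i j))) ler_sqr ?nnegrE//; lra.
have q0 : 0 < q by rewrite (lt_le_trans _ sq)// exprn_gt0.
pose G := invmx (A *m A^T).
have GT : G^T = G by rewrite /G trmx_inv trmx_mul trmxK.
have pT : (Defs.pinv A)^T = G *m A by rewrite /Defs.pinv trmx_mul trmxK -/G GT.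
exists (- (q^-1 *: (delta_mx j ord0 *m row j (Defs.pinv A)^T))).
  move=> k l; rewrite !mxE big_ord1 !mxE eqxx andbT normrN !normrM.
  have -> : 2 * C / t = s^-1 by rewrite /s invf_div.
  rewrite normfV (ger0_norm (ltW q0)) mulrC ler_pdivrMr//.
  apply: (@le_trans _ _ `|Defs.pinv A l j|).
    by rewrite normr_nat mulr_natl [in leRHS]mxE; case: (k == j); rewrite ?mulr1n ?mulr0n.
  rewrite mulrC ler_pdivlMr//.
  (* Both [s ^+ 2] and the square of the entry are at most q, hence so is their product [|v_l| * s],
     by the arithmetic-geometric mean inequality. *)
  have := sqr_le_sum (fun i => Defs.pinv A i j) l.
  rewrite -/q -(real_normK (num_real (Defs.pinv A l j))).
  have := sqr_ge0 (`|Defs.pinv A l j| - s); nra.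
apply/rank_lt_left_ker; exists (row j G).
  apply/eqP => /(congr1 (fun w => w *m (A *m A^T))).
  rewrite mul0mx -row_mul /G mulVmx ?gram_unit// row1.
  by move/rowP => /(_ j); rewrite !mxE !eqxx => /eqP; rewrite oner_eq0.
rewrite mulmxDr mulmxN -scalemxAr mulmxA -row_mul -pT.
have -> : row j G *m delta_mx j ord0 = q%:M.
  apply/matrixP => x y; rewrite !ord1 mulmx_delta !mxE eqxx mulr1n.
  have -> : q = ((Defs.pinv A)^T *m Defs.pinv A) j j.
    by rewrite mxE; apply: eq_bigr => k _; rewrite [in RHS]mxE expr2.
  by rewrite pT -mulmxA mulmx_pinv// mulmx1.
by rewrite mul_scalar_mx scalerA mulVf ?scale1r ?subrr// lt0r_neq0.
Qed.

End NearSingular.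

Lemma continuous_mulr_cst (R : realType) (T : topologicalType) (f : T -> R) c :
  continuous f -> continuous (fun x => f x * c).
Proof. by move=> cf x; apply: cvgMl; exact: cf. Qed.

(** * Bernstein basis: identities, derivatives, continuity and bounds on the cube *)

Section Bernstein.
Context {R : realType} {n : nat} {m : 'I_n.+1 -> nat}.
Implicit Types (g : bpoly R m) (x y : 'rV[R]_n.+1).

(** The formal polynomial behind [bern], so that derivatives, continuity and bounds come from
    [{poly R}]. *)
Definition bernP (d i : nat) : {poly R} :=
  'C(d, i)%:R%:P * (1 - 'X) ^+ (d - i) * 'X^i.

Lemma bern_horner d i t : bern d i t = (bernP d i).[t].
Proof. by rewrite /bern /bernP !hornerE. Qed.

Lemma sum_bern d (t : R) : \sum_(i < d.+1) bern d i t = 1.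
Proof.
rewrite -[RHS](expr1n R d) -[in RHS](subrK t 1) exprDn.
by apply: eq_bigr => i _; rewrite /bern -mulrA mulr_natl.
Qed.

(** The identity [i * 'C(d, i) = d * 'C(d - 1, i - 1)] pulls out a factor t and leaves the partition
    of unity of degree [d - 1]. *)
Lemma sum_bern_id d (t : R) : (0 < d)%N ->
  \sum_(i < d.+1) bern d i t * (i%:R / d%:R) = t.
Proof.
case: d => // d _; rewrite big_ord_recl /= mul0r mulr0 add0r.
rewrite -[RHS]mulr1 -[in RHS](sum_bern d t) mulr_sumr.
apply: eq_bigr => i _; rewrite /bern /bump /= add1n subSS.
have : i.+1%:R * 'C(d.+1, i.+1)%:R = d.+1%:R * 'C(d, i)%:R :> R.
  by rewrite -!natrM mul_bin_diag.
have d0 : d.+1%:R != 0 :> R by rewrite pnatr_eq0.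
move=> e; apply: (mulfI d0); rewrite exprS.
transitivity (i.+1%:R * 'C(d.+1, i.+1)%:R * (1 - t) ^+ (d - i) * (t * t ^+ i)).
  by field.
by rewrite e; ring.
Qed.

(** The index range varies with j, so indices are moved to [fprod] and each sum to one over tagged
    pairs, where a product distributes over sums. *)
Lemma sum_dffun_prod (F : forall j : 'I_n.+1, 'I_(m j).+1 -> R) :
  \sum_(i : bidx m) \prod_j F j (i j) = \prod_j \sum_(k < (m j).+1) F j k.
Proof.
pose T j := 'I_(m j).+1 : finType.
rewrite (reindex (@dffun_of_fprod _ T)) /=; last first.
  exact/onW_bij/dffun_of_fprod_bij.
transitivity (\sum_(t : fprod T) \prod_(j in 'I_n.+1) finfun (F j) (t j)).
  by apply: eq_bigr => t _; apply: eq_bigr => j _; rewrite !ffunE.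
rewrite (big_fprod 1 +%R (fun j => finfun (F j))).
under [RHS]eq_bigr do rewrite (big_tag (T_ := T) F).
rewrite bigA_distr_big_dep; apply: eq_bigr => g _; apply: eq_bigr => j _.
rewrite /untag; case: eqP => // e; by rewrite ffunE.
Qed.

Definition bbasis (i : bidx m) x : R :=
  \prod_(j < n.+1) bern (m j) (i j) (x ord0 j).

(** The j-th partial derivative of [bbasis i], kept as a product of polynomial values so that the
    continuity and boundedness arguments for [bbasis] apply to it too. *)
Definition dbbasis (i : bidx m) (j : 'I_n.+1) x : R :=
  \prod_(k < n.+1) (if k == j then (bernP (m k) (i k))^`()
                    else bernP (m k) (i k)).[x ord0 k].

Lemma beval_coord g x k : beval g x ord0 k = \sum_i bbasis i x * g i ord0 k.
Proof. by rewrite summxE; apply: eq_bigr => i _; rewrite mxE. Qed.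

Lemma bbasis_shift i j x h :
  bbasis i (h *: delta_mx ord0 j + x) =
  (bernP (m j) (i j)).[h + x ord0 j] *
  \prod_(k | k != j) bern (m k) (i k) (x ord0 k).
Proof.
rewrite /bbasis (bigD1 j)//= !mxE !eqxx mulr1 bern_horner; congr (_ * _).
by apply: eq_bigr => k /negPf kj; rewrite !mxE eqxx kj mulr0 add0r.
Qed.

Lemma dbbasisE i j x :
  dbbasis i j x = (bernP (m j) (i j))^`().[x ord0 j] *
  \prod_(k | k != j) bern (m k) (i k) (x ord0 k).
Proof.
rewrite /dbbasis (bigD1 j)//= eqxx; congr (_ * _).
by apply: eq_bigr => k /negPf kj; rewrite kj bern_horner.
Qed.

Local Open Scope classical_set_scope.

(** Only the j-th factor moves with h, so this is the difference quotient of one univariate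
    polynomial times the constant Q. *)
Lemma bbasis_quotient_cvg i j x :
  h^-1 * (bbasis i (h *: delta_mx ord0 j + x) - bbasis i x) @[h --> 0^']
  --> dbbasis i j x.
Proof.
set Q := \prod_(k | k != j) bern (m k) (i k) (x ord0 k).
set b := bernP (m j) (i j).
have -> : (fun h => h^-1 * (bbasis i (h *: delta_mx ord0 j + x) - bbasis i x))
   = (fun h => h^-1 *: ((horner b \o shift (x ord0 j)) (h *: 1) - b.[x ord0 j]) * Q).
  apply/funext => h; rewrite bbasis_shift -[in bbasis i x](add0r x).
  rewrite -[in bbasis i _](scale0r (delta_mx ord0 j)) bbasis_shift add0r /=.
  by rewrite -mulrBl [_ *: 1]mulr1 mulrA.
rewrite dbbasisE; apply: cvgMl.
have := is_derive_poly b (x ord0 j) => -[db <-]; exact: db.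
Qed.

Lemma derive_beval g x j :
  'D_(delta_mx ord0 j) (beval g) x = \sum_i dbbasis i j x *: g i.
Proof.
apply/cvg_lim => //.
have -> : (fun h => h^-1 *: ((beval g \o shift x) (h *: delta_mx ord0 j) - beval g x))
  = (fun h => \sum_i (h^-1 * (bbasis i (h *: delta_mx ord0 j + x) - bbasis i x)) *: g i).
  apply/funext => h /=; rewrite /beval -sumrB scaler_sumr.
  by apply: eq_bigr => i _; rewrite -scalerBl scalerA.
apply: cvg_big => [|i _].
  exact: add_continuous.
by apply: cvgZl; exact: bbasis_quotient_cvg.
Qed.

Lemma jac_coord g x k j : jac g x k j = \sum_i dbbasis i j x * g i ord0 k.
Proof.
rewrite mxE derive_beval summxE; by apply: eq_bigr => i _; rewrite mxE.
Qed.

Lemma jacD g1 g2 x : jac (g1 + g2) x = jac g1 x + jac g2 x.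
Proof.
apply/matrixP => k j; rewrite [RHS]mxE !jac_coord -big_split/=.
by apply: eq_bigr => i _; rewrite ffunE mxE mulrDr.
Qed.

Lemma bevalD g1 g2 x : beval (g1 + g2) x = beval g1 x + beval g2 x.
Proof.
rewrite /beval -big_split/=.
by apply: eq_bigr => i _; rewrite ffunE scalerDr.
Qed.

Lemma horner_coord_continuous (q : {poly R}) (k : 'I_n.+1) :
  continuous (fun x : 'rV[R]_n.+1 => q.[x ord0 k]).
Proof.
move=> x; apply: (@continuous_comp _ _ _ (fun x : 'rV[R]_n.+1 => x ord0 k) (horner q)).
  exact: coord_continuous.
exact: continuous_horner.
Qed.

Lemma bbasis_continuous i : continuous (bbasis i).
Proof.
apply: continuous_big => [|k _]; first exact: mul_continuous.
under eq_fun do rewrite bern_horner.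
exact: horner_coord_continuous.
Qed.

Lemma dbbasis_continuous i j : continuous (dbbasis i j).
Proof.
apply: continuous_big => [|k _]; first exact: mul_continuous.
exact: horner_coord_continuous.
Qed.

Lemma beval_coord_continuous g k : continuous (fun x => beval g x ord0 k).
Proof.
under eq_fun do rewrite beval_coord.
apply: continuous_big => [|i _]; first exact: add_continuous.
exact/continuous_mulr_cst/bbasis_continuous.
Qed.

Lemma jac_coord_continuous g k j : continuous (fun x => jac g x k j).
Proof.
under eq_fun do rewrite jac_coord.
apply: continuous_big => [|i _]; first exact: add_continuous.
exact/continuous_mulr_cst/dbbasis_continuous.
Qed.

(** The summand 1 makes the bound positive, so that the product of such bounds in
    [prod_horner_bounded] is positive too. *)
Lemma horner_le_coefs (q : {poly R}) t :
  0 <= t <= 1 -> `|q.[t]| <= 1 + \sum_(i < size q) `|q`_i|.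
Proof.
move=> /andP[t0 t1]; rewrite horner_coef (le_trans (ler_norm_sum _ _ _))//.
rewrite ler_wpDl//; apply: ler_sum => i _; rewrite normrM ler_piMr//.
by rewrite normrX exprn_ile1// ger0_norm.
Qed.

Lemma prod_horner_bounded (q : 'I_n.+1 -> {poly R}) :
  exists2 C : R, 0 < C & forall x, @cube R n x -> `|\prod_k (q k).[x ord0 k]| <= C.
Proof.
exists (\prod_k (1 + \sum_(i < size (q k)) `|(q k)`_i|)).
  by apply: prodr_gt0 => k _; rewrite ltr_pwDl// sumr_ge0.
move=> x xc; rewrite normr_prod; apply: ler_prod => k _.
by rewrite normr_ge0 horner_le_coefs.
Qed.

End Bernstein.

(** * Size of values and Jacobians in terms of control points, and affine perturbations *)

Section Perturbation.
Context {R : realType} {n : nat} {m : 'I_n.+1 -> nat}.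
Implicit Types (f g : bpoly R m) (x y : 'rV[R]_n.+1) (p : \bar R).

Lemma entry_le_bnorm p g i k : (1 <= p)%E -> `|g i ord0 k| <= bnorm p g.
Proof.
move=> p1; apply: le_trans (entry_le_pnorm (g i) ord0 k p1) _.
exact: (le_bigmax_cond _ (fun i => pnorm p (g i))).
Qed.

Lemma bnorm_ge0 p g : 0 <= bnorm p g.
Proof. exact: bigmax_ge_id. Qed.

Lemma bnorm0_eq0 p g : (1 <= p)%E -> bnorm p g <= 0 -> g = 0.
Proof.
move=> p1 g0; apply/ffunP => i; rewrite ffunE; apply: (pnorm0_eq0 p1).
apply: le_trans g0; exact: (le_bigmax_cond _ (fun i => pnorm p (g i))).
Qed.

Lemma bnorm_le_entries p g B : (1 <= p)%E -> 0 <= B ->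
  (forall i k, `|g i ord0 k| <= B) -> bnorm p g <= n.+1%:R * B.
Proof.
move=> p1 B0 gB; apply/bigmax_leP; split=> [|i _]; first by rewrite mulr_ge0.
have := @pnorm_le_entries _ p _ _ (g i) B p1 B0; rewrite mul1n; apply=> j k.
by rewrite ord1.
Qed.

Lemma uniformly_bounded (I : finType) (T : Type) (A : set T) (F : I -> T -> R) :
  (forall i, exists2 C : R, 0 < C & forall z : T, A z -> `|F i z| <= C) ->
  exists2 C : R, 0 < C & forall i (z : T), A z -> `|F i z| <= C.
Proof.
move=> bF; have /choice[C HC] : forall i, exists C : R,
    0 < C /\ forall z : T, A z -> `|F i z| <= C.
  by move=> i; have [C ? ?] := bF i; exists C.
exists (1 + \sum_i C i).
  by rewrite ltr_pwDl// sumr_ge0// => i _; apply: ltW; case: (HC i).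
move=> i z Az; apply: le_trans (proj2 (HC i) z Az) _.
rewrite ler_wpDl// (bigD1 i)//= lerDl sumr_ge0// => j _.
by apply: ltW; case: (HC j).
Qed.

(** Values and partial derivatives are linear in the control points, with coefficients bounded on
    the cube. Through L the degrees enter the constant of part (1). *)
Lemma evaluation_bound p : (1 <= p)%E -> exists2 L : R, 0 < L &
  forall g x, @cube R n x ->
    (forall k, `|beval g x ord0 k| <= L * bnorm p g) /\
    (forall k j, `|jac g x k j| <= L * bnorm p g).
Proof.
move=> p1.
have [C C0 HC] : exists2 C : R, 0 < C & forall (i : bidx m) x,
    @cube R n x -> `|bbasis i x| <= C.
  apply: uniformly_bounded => i.
  have [C C0 HC] := prod_horner_bounded (fun k => bernP (R := R) (m k) (i k)).
  exists C => // x xc; rewrite /bbasis.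
  by under eq_bigr do rewrite bern_horner; exact: HC.
have [D D0 HD] : exists2 D : R, 0 < D & forall (ij : bidx m * 'I_n.+1) x,
    @cube R n x -> `|dbbasis ij.1 ij.2 x| <= D.
  apply: uniformly_bounded => -[i j].
  exact: (prod_horner_bounded (fun k =>
    if k == j then (bernP (m k) (i k))^`() else bernP (m k) (i k))).
have sum_le (F : bidx m -> R) B g k : 0 <= B -> (forall i, `|F i| <= B) ->
    B <= C + D ->
    `|\sum_i F i * g i ord0 k| <= #|{: bidx m}|.+1%:R * (C + D) * bnorm p g.
  move=> B0 FB BCD; apply: le_trans (ler_norm_sum _ _ _) _.
  apply: (@le_trans _ _ (\sum_(i : bidx m) (C + D) * bnorm p g)).
    apply: ler_sum => i _; rewrite normrM ler_pM ?entry_le_bnorm//.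
    exact: le_trans (FB i) BCD.
  rewrite sumr_const -[leLHS]mulr_natl -[leRHS]mulrA.
  apply: ler_wpM2r; last by rewrite ler_nat.
  by rewrite mulr_ge0 ?bnorm_ge0// addr_ge0// ltW.
exists (#|{: bidx m}|.+1%:R * (C + D)); first by rewrite mulr_gt0// addr_gt0.
move=> g x xc; split=> [k|k j].
  rewrite beval_coord; apply: (sum_le _ C) => [|i|].
  - exact: ltW.
  - exact: HC.
  - by rewrite lerDl ltW.
rewrite jac_coord; apply: (sum_le _ D) => [|i|].
- exact: ltW.
- exact: (HD (i, j)).
- by rewrite lerDr ltW.
Qed.

Lemma sum_bbasis x : \sum_i bbasis (m := m) i x = 1.
Proof.
rewrite (sum_dffun_prod (fun j k => bern (m j) k (x ord0 j))).
by rewrite big1// => j _; exact: sum_bern.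
Qed.

Lemma sum_bbasis_node j x : (0 < m j)%N ->
  \sum_i bbasis (m := m) i x * ((i j)%:R / (m j)%:R) = x ord0 j.
Proof.
move=> mj.
transitivity (\sum_(i : bidx m) \prod_k (bern (m k) (i k) (x ord0 k) *
    (if k == j then (i k)%:R / (m k)%:R else 1))).
  apply: eq_bigr => i _; rewrite big_split/=; congr (_ * _).
  by rewrite (bigD1 j)//= eqxx big1 ?mulr1// => k /negPf ->.
rewrite (sum_dffun_prod (fun k l => bern (m k) l (x ord0 k) *
    (if k == j then l%:R / (m k)%:R else 1))).
rewrite (bigD1 j)//= eqxx sum_bern_id// big1 ?mulr1// => k /negPf ->.
by under eq_bigr do rewrite mulr1; exact: sum_bern.
Qed.

(* The Bernstein form reproduces the affine map y |-> c + E y from the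
   control points obtained by sampling it on the grid (i_j / m_j)_j. *)
Definition affine_bpoly (c : 'rV[R]_n) (E : 'M[R]_(n, n.+1)) : bpoly R m :=
  [ffun i : bidx m => c + (\row_j ((i j)%:R / (m j)%:R)) *m E^T].

(** The partition of unity reproduces c, and [sum_bbasis_node] the linear part; with a zero degree
    the corresponding coordinate could not be represented. *)
Lemma beval_affine c E x : (forall j, (0 < m j)%N) ->
  beval (affine_bpoly c E) x = c + x *m E^T.
Proof.
move=> m0; rewrite /beval.
under eq_bigr do rewrite ffunE scalerDr scalemxAl.
rewrite big_split/= -scaler_suml -mulmx_suml.
rewrite (sum_bbasis x) scale1r; congr (_ + _ *m _).
apply/rowP => j; rewrite summxE -[RHS](sum_bbasis_node _ (m0 j)).
by apply: eq_bigr => i _; rewrite !mxE.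
Qed.

Local Open Scope classical_set_scope.

Lemma jac_affine c E x : (forall j, (0 < m j)%N) ->
  jac (affine_bpoly c E) x = E.
Proof.
move=> m0; apply/matrixP => k j; rewrite mxE.
suff -> : 'D_(delta_mx ord0 j) (beval (affine_bpoly c E)) x = row j E^T.
  by rewrite !mxE.
apply/cvg_lim => //; apply: cvg_near_cst.
near=> h; have h0 : h != 0 by near: h; exact: nbhs_dnbhs_neq.
rewrite /= !beval_affine// mulmxDl opprD addrACA subrr add0r addrK.
by rewrite -scalemxAl scalerA mulVf// scale1r -rowE.
Unshelve. all: by end_near. Qed.

Lemma cubeP x j : @cube R n x -> 0 <= x ord0 j /\ x ord0 j <= 1.
Proof. by move=> /(_ j) /andP. Qed.

Lemma degenerate_perturbation p f x (E : 'M[R]_(n, n.+1)) e :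
  (1 <= p)%E -> (forall j, (0 < m j)%N) -> @cube R n x -> 0 <= e ->
  (forall k, `|beval f x ord0 k| <= e) -> (forall k j, `|E k j| <= e) ->
  (\rank (jac f x + E)%R < n)%N ->
  exists2 fh, degenerate fh & bnorm p (fh - f) <= n.+1%:R * (n.+2%:R * e).
Proof.
move=> p1 m0 xc e0 fe Ee rE.
(* The constant term is chosen so that g takes the value [- beval f x] at x. *)
pose g := affine_bpoly (- beval f x - x *m E^T) E.
exists (f + g).
  exists x; first exact/mem_set.
  split; last by rewrite jacD jac_affine.
  by rewrite bevalD beval_affine// subrK subrr.
rewrite [f + g]addrC addrK; apply: bnorm_le_entries; rewrite ?mulr_ge0//.
move=> i k.
have -> : g i = - beval f x + (\row_j ((i j)%:R / (m j)%:R) - x) *m E^T.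
  by rewrite ffunE mulmxBl -addrA [- (x *m _) + _]addrC.
(* The factor [n.+2] is one e for the value plus [n.+1] for the products of entries of E with
   entries of node minus x, which lie in [-1, 1]. *)
rewrite -(addn1 n.+1) addnC natrD mulrDl mul1r 2!mxE.
apply: le_trans (ler_normD _ _) _; rewrite normrN; apply: lerD => //.
rewrite mxE; apply: norm_sum_le => j.
rewrite !mxE normrM -[leRHS]mul1r ler_pM//.
have [x0 x1] := cubeP j xc.
have : 0 <= (i j)%:R / (m j)%:R :> R by rewrite divr_ge0.
have : (i j)%:R / (m j)%:R <= 1 :> R.
  by rewrite ler_pdivrMr ?ltr0n// mul1r ler_nat -ltnS.
by move=> ? ?; rewrite ler_norml; lra.
Qed.

End Perturbation.

(** * Finiteness of the supremum, and the two distance estimates *)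

Section Conditioning.
Context {R : realType} {n : nat} {m : 'I_n.+1 -> nat}.
Implicit Types (f g : bpoly R m) (x y : 'rV[R]_n.+1) (p : \bar R).
Local Open Scope classical_set_scope.

Lemma kappa_loc_ge p f x (t : R) : (1 <= p)%E -> 0 < t ->
  (t%:E <= kappa_loc p f x)%E ->
  (forall k, `|beval f x ord0 k| <= t^-1) /\
  ((\rank (jac f x) >= n)%N -> t <= opnorm p (Defs.pinv (jac f x))).
Proof.
move=> p1 t0; rewrite le_min => /andP[tf tJ]; split=> [k|rJ]; last first.
  by move: tJ; rewrite ltnNge rJ /= lee_fin.
move: tf; case: eqVneq => [->|f0].
  by move=> _; rewrite mxE normr0 invr_ge0 ltW.
rewrite lee_fin => tf; apply: le_trans (entry_le_pnorm _ ord0 k p1) _.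
have fp : 0 < pnorm p (beval f x).
  by rewrite lt_def pnorm_ge0 andbT; apply: contra f0 => /eqP e;
     apply/eqP/(pnorm0_eq0 p1); rewrite e.
by rewrite -[leLHS]invrK lef_pV2// posrE invr_gt0.
Qed.

Lemma kappa_loc_le p f x (K : R) : (kappa_loc p f x <= K%:E)%E ->
  (beval f x <> 0 /\ (pnorm p (beval f x))^-1 <= K) \/
  ((\rank (jac f x) >= n)%N /\ opnorm p (Defs.pinv (jac f x)) <= K).
Proof.
rewrite ge_min => /orP[|].
  by case: eqP => // f0; rewrite lee_fin; left.
by case: ltnP => // rJ; rewrite lee_fin; right.
Qed.

Lemma kappa_loc_gt0 p f x : (1 <= p)%E -> (0 < n)%N -> (0 < kappa_loc p f x)%E.
Proof.
move=> p1 n0; rewrite lt_min; apply/andP; split.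
  case: eqVneq => // f0; rewrite lte_fin invr_gt0 lt_def pnorm_ge0 andbT.
  by apply: contra f0 => /eqP e; apply/eqP/(pnorm0_eq0 p1); rewrite e.
case: ltnP => // rJ; rewrite lte_fin ltNge; apply/negP => o0.
have J0 : Defs.pinv (jac f x) = 0.
  apply/matrixP => i j; rewrite [RHS]mxE; apply/eqP.
  by rewrite -normr_le0 (le_trans _ o0)// entry_le_opnorm.
have := mulmx_pinv rJ; rewrite J0 mulmx0 => /matrixP /(_ (Ordinal n0) (Ordinal n0)).
by rewrite !mxE eqxx => /esym/eqP; rewrite oner_eq0.
Qed.

Lemma cube_compact : compact (@cube R n).
Proof.
have -> : @cube R n = [set v : 'rV[R]_n.+1 | forall i, `[0, 1]%classic (v ord0 i)].
  by apply/seteqP; split => v /= vc j; have := vc j; rewrite in_itv.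
by apply: (@rV_compact R n.+1 (fun=> `[0, 1]%classic)) => _; exact: segment_compact.
Qed.

Lemma unit_sphere_compact : compact [set u : 'rV[R]_n | `|u| = 1].
Proof.
apply: bounded_closed_compact.
  exists 1; split=> // M M1 u /= ->; exact: ltW.
have -> : [set u : 'rV[R]_n | `|u| = 1] = Num.norm @^-1` [set 1 : R] by [].
apply: closed_comp => [u _|]; first exact: norm_continuous.
exact: closed_eq.
Qed.

Lemma entry_le_norm (u : 'rV[R]_n) k : `|u ord0 k| <= `|u|.
Proof.
rewrite [leRHS]mx_normrE.
exact: (le_bigmax_cond _ (fun i : 'I_1 * 'I_n => `|u i.1 i.2|) (j := (ord0, k))).
Qed.

Lemma continuous_sumr (T : topologicalType) (I : finType) (F : I -> T -> R) :
  (forall i, continuous (F i)) -> continuous (fun z => \sum_i F i z).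
Proof.
by move=> cF; apply: continuous_big => [|i _]; [exact: add_continuous|exact: cF].
Qed.

Lemma continuous_normr (T : topologicalType) (F : T -> R) :
  continuous F -> continuous (fun z => `|F z|).
Proof. by move=> cF z; apply: cvg_norm; exact: cF. Qed.

(** For [z.2] nonzero, this vanishes exactly when f is zero at [z.1] and [z.2] is a left kernel
    vector of the Jacobian there: a continuous substitute for the rank condition. *)
Definition degeneracy f (z : 'rV[R]_n.+1 * 'rV[R]_n) : R :=
  \sum_k `|beval f z.1 ord0 k| +
  \sum_j `|\sum_k z.2 ord0 k * jac f z.1 k j|.

Lemma degeneracy_continuous f : continuous (degeneracy f).
Proof.
have cfst F : continuous F -> continuous (fun z : 'rV[R]_n.+1 * 'rV[R]_n => F z.1 : R).
  by move=> cF z; apply: continuous_comp; [exact: cvg_fst|exact: cF].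
have csnd F : continuous F -> continuous (fun z : 'rV[R]_n.+1 * 'rV[R]_n => F z.2 : R).
  by move=> cF z; apply: continuous_comp; [exact: cvg_snd|exact: cF].
move=> z; apply: cvgD.
  apply: continuous_sumr => k; apply: continuous_normr.
  apply: (cfst (fun x => beval f x ord0 k)); exact: beval_coord_continuous.
apply: continuous_sumr => j; apply: continuous_normr; apply: continuous_sumr => k.
move=> w; apply: cvgM.
  by apply: (csnd (fun u => u ord0 k)); exact: coord_continuous.
apply: (cfst (fun x => jac f x k j)); exact: jac_coord_continuous.
Qed.

Lemma degeneracy_bounded_below f : (0 < n)%N -> ~ degenerate f ->
  exists2 d : R, 0 < d & forall x (u : 'rV[R]_n),
    @cube R n x -> u != 0 -> d <= degeneracy f (x, `|u|^-1 *: u).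
Proof.
move=> n0 fN.
have normalized (u : 'rV[R]_n) : u != 0 -> `| `|u|^-1 *: u| = 1.
  by move=> u0; rewrite normrZ normfV normr_id mulVf// normr_eq0.
pose e1 : 'rV[R]_n := delta_mx ord0 (Ordinal n0).
have e1_neq0 : e1 != 0.
  apply/eqP => /rowP /(_ (Ordinal n0)); rewrite !mxE !eqxx => /eqP.
  by rewrite oner_eq0.
have [|||[x u] /set_mem [/= xc u1] zmin] := @compact_EVT_min _ R (degeneracy f)
    (@cube R n `*` [set u : 'rV[R]_n | `|u| = 1]).
- exists (0, `|e1|^-1 *: e1).
  by split=> [j|] /=; [rewrite mxE lexx ler01|exact: normalized].
- by apply: compact_setX; [exact: cube_compact|exact: unit_sphere_compact].
- exact/continuous_subspaceT/degeneracy_continuous.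
exists (degeneracy f (x, u)); last first.
  move=> y w yc w0; apply: zmin; apply/mem_set; split => //=.
  exact: normalized.
have s1 : 0 <= \sum_k `|beval f x ord0 k| by exact: sumr_ge0.
have s2 : 0 <= \sum_j `|\sum_k u ord0 k * jac f x k j| by exact: sumr_ge0.
(* A zero minimum makes every term vanish, so x would be a degenerate point with u in the left
   kernel. *)
rewrite lt_def addr_ge0// andbT; apply/eqP => /eqP; rewrite paddr_eq0//=.
rewrite !psumr_eq0// => /andP[/allP f0 /allP J0]; apply: fN.
exists x; first exact/mem_set.
split.
  apply/rowP => k; rewrite [RHS]mxE; apply/eqP; rewrite -normr_eq0.
  by have := f0 k (mem_index_enum _).
apply/rank_lt_left_ker; exists u.
  by rewrite -normr_eq0 u1 oner_eq0.
apply/rowP => j; rewrite !mxE; apply/eqP; rewrite -normr_eq0.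
by have := J0 j (mem_index_enum _).
Qed.

(* The constant of [near_singular] for n x (n+1) matrices. *)
Definition singular_const : R := 2 * (n.+2 * n)%:R.
Local Notation C := singular_const.

Lemma singular_const_ge1 : (0 < n)%N -> 1 <= C.
Proof. by move=> n0; rewrite /C -natrM ler1n !muln_gt0. Qed.

(** The value bound [t^-1] is weakened to [C / t], using [C >= 1], so that one size governs both the
    value and E. *)
Lemma kappa_loc_perturbation p f x (t : R) : (1 <= p)%E -> (0 < n)%N -> 0 < t ->
  (t%:E <= kappa_loc p f x)%E ->
  exists2 E : 'M[R]_(n, n.+1),
    (forall k, `|beval f x ord0 k| <= C / t) /\ (forall k j, `|E k j| <= C / t) &
    (\rank (jac f x + E)%R < n)%N.
Proof.
move=> p1 n0 t0 /(kappa_loc_ge p1 t0)[ft Jt].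
have [E EC rE] := near_singular p1 n0 t0 Jt; exists E => //; split=> // k.
apply: le_trans (ft k) _; rewrite ler_peMl ?singular_const_ge1// invr_ge0 ltW //.
Qed.

(** A local condition number at least t yields E of size [C / t] and u with
    [u *m (jac f x + E) = 0], so [degeneracy] at x and the normalized u is at most [N / t]. Its
    lower bound d then gives [t <= N / d]. *)
Lemma kappa_sup_fin p f : (1 <= p)%E -> (0 < n)%N -> ~ degenerate f ->
  exists2 K : R, 0 < K & ereal_sup [set kappa_loc p f x | x in @cube R n] = K%:E.
Proof.
move=> p1 n0 fN; have [d d0 dP] := degeneracy_bounded_below n0 fN.
(* [degeneracy] consists of n values of size [C / t] and of [n.+1] column sums with n terms of that
   size. *)
pose N : R := (n%:R + n.+1%:R * n%:R) * C; pose M := N / d.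
have C0 : 0 < C by apply: lt_le_trans (singular_const_ge1 n0).
have bound x (t : R) : @cube R n x -> 0 < t -> (t%:E <= kappa_loc p f x)%E -> t <= M.
  move=> xc t0 /(kappa_loc_perturbation p1 n0 t0)[E [fe Ee]].
  move/rank_lt_left_ker => [u u0 uE].
  rewrite ler_pdivlMr// mulrC -ler_pdivlMr//.
  apply: le_trans (dP x u xc u0) _.
  rewrite /N -mulrA mulrDl; apply: lerD.
    rewrite -[in leRHS](card_ord n) mulr_natl -sumr_const.
    by apply: ler_sum => k _.
  rewrite -mulrA -[in leRHS](card_ord n.+1) mulr_natl -sumr_const.
  apply: ler_sum => j _ /=.
  set w := `|u|^-1 *: u.
  have w1 k : `|w ord0 k| <= 1.
    rewrite mxE normrM normfV normr_id mulrC ler_pdivrMr ?normr_gt0// mul1r.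
    exact: entry_le_norm.
  have -> : \sum_k w ord0 k * jac f x k j = - \sum_k w ord0 k * E k j.
    have : w *m (jac f x + E) = 0 by rewrite -scalemxAl uE scaler0.
    rewrite mulmxDr => /eqP; rewrite addr_eq0 => /eqP/rowP/(_ j).
    by rewrite 3!mxE.
  rewrite normrN; apply: norm_sum_le => k.
  by rewrite normrM -[leRHS]mul1r ler_pM.
set S := (X in ereal_sup X).
have c0 : @cube R n 0 by move=> j; rewrite mxE lexx ler01.
have S0 : (0 < ereal_sup S)%E.
  apply: lt_le_trans (kappa_loc_gt0 f 0 p1 n0) _.
  by apply: ereal_sup_ubound; exists 0.
have SM : (ereal_sup S <= M%:E)%E.
  apply: ge_ereal_sup => _ [x xc <-].
  have := kappa_loc_gt0 f x p1 n0; have := bound x ^~ xc.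
  case: (kappa_loc p f x) => [r| |]//= bx r0.
    by rewrite lee_fin; apply: bx; rewrite ?lee_fin// -lte_fin.
  (* An infinite local condition number would exceed the positive number [|M| + 1], which is larger
     than the bound M. *)
  have M1 : 0 < `|M| + 1 by rewrite ltr_wpDl.
  have := bx _ M1 (leey _); rewrite leNgt => /negP MN; exfalso; apply: MN.
  by rewrite (le_lt_trans (ler_norm _))// ltrDl.
move: S0 SM; case: (ereal_sup S) => [r| |]// r0 _.
by exists r => //; rewrite -lte_fin.
Qed.

(** With [D = bnorm p (ft - f)]: if the value attains the minimum, f(x) is minus the value of
    [ft - f], of size at most [L * D], while [1 <= |f(x)| * K]. Otherwise a left kernel vector u of
    the Jacobian of ft satisfies [u = - (u *m G *m P)], and comparing norms gives [1 <= B * (D * K)]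
    again. *)
Lemma degenerate_far p : (1 <= p)%E -> (0 < n)%N -> exists2 c : R, 0 < c &
  forall f ft x (K : R), 0 < K -> @cube R n x -> (kappa_loc p f x <= K%:E)%E ->
    beval ft x = 0 -> (\rank (jac ft x) < n)%N -> c < bnorm p (ft - f) * K.
Proof.
move=> p1 n0; have [L L0 HL] := @evaluation_bound R n m p p1.
(* Dominates both factors that arise: [n.+1 * L] from the value and [n.+1 * n * L] from
   [u *m G *m P]. *)
pose B : R := n.+1%:R * n.+1%:R * L.
have B0 : 0 < B by rewrite !mulr_gt0.
(* The factor 2 makes the conclusion strict, so that it contradicts the non-strict hypothesis on
   ft. *)
exists ((2 * B)^-1); first by rewrite invr_gt0 mulr_gt0.
move=> f ft x K K0 xc fK ft0 rft.
have [HLf HLJ] := HL (ft - f) x xc; set D := bnorm p (ft - f) in HLf HLJ *.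
have D0 : 0 <= D by exact: bnorm_ge0.
have ftE : ft = f + (ft - f) by rewrite addrC subrK.
suff le1 : 1 <= B * (D * K).
  rewrite invfM ltr_pdivrMr// [X in _ < X]mulrC; apply: lt_le_trans le1.
  by rewrite invf_lt1// ltr1n.
have [[f0 fK']|[rJ JK]] := kappa_loc_le fK.
  have fe : beval f x = - beval (ft - f) x.
    by apply/eqP; rewrite -addr_eq0 -bevalD -ftE ft0.
  have fp : 0 < pnorm p (beval f x).
    rewrite lt_def pnorm_ge0 andbT; apply/eqP => e.
    by apply/f0/(pnorm0_eq0 p1); rewrite e.
  have le2 : 1 <= pnorm p (beval f x) * K.
    by rewrite mulrC -ler_pdivrMr// mul1r.
  apply: le_trans le2 _; rewrite mulrA ler_pM2r//.
  have := @pnorm_le_entries _ p _ _ (beval f x) (L * D) p1.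
  rewrite mul1n => le3; apply: le_trans (le3 _ _) _.
  - by rewrite mulr_ge0// ltW.
  - by move=> i k; rewrite ord1 fe mxE normrN.
  - rewrite /B mulrA ler_wpM2r// ler_wpM2r ?(ltW L0)//.
    by rewrite ler_peMr// ler1n.
have /rank_lt_left_ker [u u0 uft] := rft.
pose P := Defs.pinv (jac f x); pose G := jac (ft - f) x.
have ue : u = - (u *m G *m P).
  have : u *m jac f x = - (u *m G).
    by apply/eqP; rewrite -addr_eq0 -mulmxDr -jacD -ftE uft.
  by move=> e; rewrite -mulNmx -e -mulmxA mulmx_pinv// mulmx1.
have up : 0 < `|u| by rewrite normr_gt0.
(* The norm on row vectors is the maximum norm, so some coordinate attains it. *)
have [k uk] : exists k, `|u| = `|u ord0 k|.
  have [|[i k] uik] := @mx_norm_neq0 _ _ _ u; first by rewrite gt_eqF.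
  by exists k; move: uik; rewrite /= (ord1 i).
have PK j l : `|P j l| <= K by apply: le_trans JK; exact: entry_le_opnorm.
have uG j : `|(u *m G) ord0 j| <= n%:R * (`|u| * (L * D)).
  rewrite mxE; apply: norm_sum_le => l; rewrite normrM ler_pM//; exact: entry_le_norm.
have : `|u| <= n.+1%:R * (n%:R * (`|u| * (L * D)) * K).
  rewrite {1}uk {1}ue mxE normrN mxE; apply: norm_sum_le => l.
  by rewrite normrM ler_pM.
have -> : n.+1%:R * (n%:R * (`|u| * (L * D)) * K) =
    `|u| * (n.+1%:R * n%:R * L * (D * K)).
  by ring.
rewrite -{1}[`|u|]mulr1 ler_pM2l// => /le_trans; apply.
rewrite /B; apply: ler_wpM2r; first by rewrite mulr_ge0// ltW.
by rewrite ler_wpM2r ?(ltW L0)// ler_wpM2l// ler_nat.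
Qed.

Lemma degenerate_near p : (1 <= p)%E -> (0 < n)%N -> (forall j, (0 < m j)%N) ->
  exists2 c : R, 0 < c & forall f x (t : R), @cube R n x -> 0 < t ->
    (t%:E <= kappa_loc p f x)%E ->
    exists2 fh, degenerate fh & bnorm p (fh - f) <= c / t.
Proof.
move=> p1 n0 m0; have C0 : 0 < C by apply: lt_le_trans (singular_const_ge1 n0).
exists (n.+1%:R * (n.+2%:R * C)); first by rewrite mulr_gt0// mulr_gt0.
move=> f x t xc t0 /(kappa_loc_perturbation p1 n0 t0)[E [fe Ee] rE].
rewrite -mulrA -(mulrA n.+2%:R C).
apply: (degenerate_perturbation p1 m0 xc _ fe Ee rE).
by rewrite divr_ge0// ltW.
Qed.

End Conditioning.

(** * Both distance estimates read through the finite supremum K *)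

Theorem theorem2 (R : realType) (n : nat) (m : 'I_n.+1 -> nat) (p : \bar R) :
  (1 <= n)%N -> (forall j, (1 <= m j)%N) -> (1 <= p)%E ->
  exists c : R, exists c' : R, 0 < c /\ 0 < c' /\
    forall f : bpoly R m, ~ degenerate f ->
      (forall ft : bpoly R m,
          ((bnorm p (ft - f) / bnorm p f)%:E <= c%:E / kappa p f)%E ->
          ~ degenerate ft) /\
      (exists2 fh : bpoly R m, degenerate fh &
          ((bnorm p (fh - f) / bnorm p f)%:E <= c'%:E / kappa p f)%E).
Proof.
move=> n0 m0 p1.
have [c c0 far] := @degenerate_far R n m p p1 n0.
have [c' c'0 near] := @degenerate_near R n m p p1 n0 m0.
(* The factor 2 pays for using a point whose local condition number exceeds only [K / 2], as the
   supremum is not claimed to be attained. *)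
exists c; exists (c' * 2); split => //; split; first by rewrite mulr_gt0.
move=> f fN; have [K K0 KE] := kappa_sup_fin p1 n0 fN.
(* The zero polynomial is degenerate, so f has positive norm. *)
have F0 : 0 < bnorm p f.
  rewrite ltNge; apply/negP => /(bnorm0_eq0 p1) f0; apply: fN.
  exists 0; first by apply/mem_set => j; rewrite mxE lexx ler01.
  rewrite f0; split.
    by rewrite /beval big1// => i _; rewrite ffunE scaler0.
  suff -> : jac (0 : bpoly R m) 0 = 0 by rewrite mxrank0.
  apply/matrixP => k j; rewrite jac_coord [RHS]mxE big1// => i _.
  by rewrite ffunE mxE mulr0.
(* Since [kappa p f] is [bnorm p f] times K, the norm of f cancels and both relative bounds become
   real inequalities. *)
have quotE (D e : R) : ((D / bnorm p f)%:E <= e%:E / kappa p f)%E = (D * K <= e).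
  rewrite /kappa KE -EFinM inver gt_eqF ?mulr_gt0// -EFinM lee_fin.
  by rewrite invfM mulrA mulrAC ler_pM2r ?invr_gt0// ler_pdivlMr.
split=> [ft|].
  rewrite quotE => ftc [x /set_mem xc [ft0 rft]].
  have : (kappa_loc p f x <= K%:E)%E.
    by rewrite -KE; apply: ereal_sup_ubound; exists x.
  by move=> /(far f ft x K K0 xc)/(_ ft0 rft); rewrite ltNge ftc.
have K2 : 0 < K / 2 by rewrite divr_gt0.
have [_ [x xc <-]] : exists2 y, [set kappa_loc p f x | x in @cube R n]%classic y &
    ((K / 2)%:E < y)%E.
  have := @ub_ereal_sup_adherent _ [set kappa_loc p f x | x in @cube R n]%classic _ K2.
  rewrite KE => /(_ isT)[y Sy]; rewrite -EFinB => yK; exists y => //.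
  by move: yK; rewrite {1}(splitr K) addrK.
move=> /ltW /(near f x _ xc K2)[fh fhD fhB]; exists fh => //.
by rewrite quotE -ler_pdivlMr//; move: fhB; rewrite invf_div mulrA.
Qed.
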